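(* Let $\phi$ be a numbering with the Kolmogorov property and let $f$ be a computable function mapping each index $x$ to a finite list of indices containing $\min_\phi(x)$. Then $|f(x)|=\Omega(\log^2 x)$ for infinitely many $x$; that is, there is a constant $c>0$ such that $|f(x)|\ge c\log^2 x$ for infinitely many $x$.
   Context: A numbering $\phi$ is given by a partial-recursive function $U:\mathbb{N}^2\to\mathbb{N}$ via $\phi_e(x)=U(e,x)$. $\phi$ has the Kolmogorov property if for every numbering $\psi$ there exist a constant $c>0$ and a (not necessarily computable) function $t$ with $t(e)\le ce+c$ and $\phi_{t(e)}=\psi_e$ for all $e$. $\min_\phi(e)$ is the least $j$ with $\phi_j=\phi_e$. $|f(x)|$ denotes the number of elements of the list $f(x)$. *)

(* Defs.v *)
From mathcomp Require Import all_boot.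
From mathcomp Require Import boolp.

Set Implicit Arguments.
Unset Strict Implicit.
Unset Printing Implicit Defensive.

(** Kleene's mu-recursive functions; [rec_code n] is the syntax of those of
    arity [n], and [eval c] is the graph of the partial function described by
    [c]. *)
Inductive rec_code : nat -> Type :=
| RZero n : rec_code n
| RSucc : rec_code 1
| RProj n (i : 'I_n) : rec_code n
| RComp m n (g : rec_code m) (h : 'I_m -> rec_code n) : rec_code n
| RPrec n (g : rec_code n) (h : rec_code n.+2) : rec_code n.+1
| RMu n (g : rec_code n.+1) : rec_code n.

Definition pgraph (n : nat) := n.-tuple nat -> nat -> Prop.

Definition comp_graph m n (G : pgraph m) (H : 'I_m -> pgraph n) : pgraph n :=
  fun v y => exists2 w : m.-tuple nat, (forall i, H i v (tnth w i)) & G w y.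

(** The function r with r(0, v) = G(v) and r(k + 1, v) = H(k, r(k, v), v). *)
Fixpoint prec_graph n (G : pgraph n) (H : pgraph n.+2) (k : nat) : pgraph n :=
  fun v y =>
    if k is k'.+1 then
      exists2 z, prec_graph G H k' v z & H [tuple of k' :: z :: v] y
    else G v y.

(** The search diverges if G(k, v) is undefined for some k below the first
    zero. *)
Definition mu_graph n (G : pgraph n.+1) : pgraph n :=
  fun v y => G [tuple of y :: v] 0
    /\ forall k, k < y -> exists z, G [tuple of k :: v] z.+1.

Fixpoint eval n (c : rec_code n) : pgraph n :=
  match c in rec_code n return pgraph n with
  | RZero _ => fun _ y => y = 0
  | RSucc => fun v y => y = (thead v).+1
  | RProj _ i => fun v y => y = tnth v i
  | RComp _ _ g h => comp_graph (eval g) (fun i => eval (h i))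
  | RPrec _ g h => fun v y =>
      prec_graph (eval g) (eval h) (thead v) [tuple of behead v] y
  | RMu _ g => mu_graph (eval g)
  end.

(** [None] stands for "undefined". *)
Definition partial_recursive n (g : n.-tuple nat -> option nat) : Prop :=
  exists c : rec_code n, forall v y, g v = Some y <-> eval c v y.

(** Finite lists are represented by their numerical codes under the effective
    bijection [CodeSeq.code] between [seq nat] and [nat]. *)
Definition computable_to_lists (f : nat -> seq nat) : Prop :=
  partial_recursive
    (fun v : 1.-tuple nat => Some (CodeSeq.code (f (thead v)))).

(** [phi e x] is U(e, x). *)
Definition numbering (phi : nat -> nat -> option nat) : Prop :=
  partial_recursive
    (fun v : 2.-tuple nat => phi (tnth v ord0) (tnth v ord_max)).

Definition kolmogorov_property (phi : nat -> nat -> option nat) : Prop :=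
  forall psi : nat -> nat -> option nat, numbering psi ->
  exists c : nat, 0 < c /\
  exists t : nat -> nat, forall e, t e <= c * e + c /\ phi (t e) =1 psi e.

Lemma ex_same_function (phi : nat -> nat -> option nat) (e : nat) :
  exists j, `[< phi j =1 phi e >].
Proof. by exists e; apply/asboolP. Qed.

Definition min_index (phi : nat -> nat -> option nat) (e : nat) : nat :=
  ex_minn (ex_same_function phi e).

(* Main.v *)
(** A dovetailed search yields a computable [X] with [phi (X e) 0 = Some e] and
    [X e = O(e)], so the functions of index [X e] are pairwise distinct.
    Suppose that [m = 2 ^ k] numbers [e] and a set of at most [m / 2] indices
    were such that all elements of the lists [f (X e)] between [m / 4] and [n m]
    lie in that set.  Such a configuration can be found by search, so that the
    [m] functions of index [X e] receive indices [O(m)] in some numbering, hence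
    in [phi].  Their minimal indices are then [m] distinct numbers below [n m]
    taken from fewer than [m] candidates, a contradiction.  The constant [n]
    depends on the constant of the numbering that performs the search; this
    circularity is avoided by making [n] a parameter encoded in the index.

    On the other hand, if the lists of many [e < 2 ^ N] have few elements at level [k],
    i.e. between [m / 4] and [n m], then a random set of candidates contains all
    the level [k] elements of at least [m] of these lists.  So for each of
    [Omega(N)] disjoint levels, at least half of the [e < 2 ^ N] have lists with
    [Omega(N)] elements at that level, and averaging gives an [e] whose list has
    [Omega(N ^ 2)] elements. *)

Require Import Defs.
From mathcomp Require Import all_boot boolp zify.

Set Implicit Arguments.
Unset Strict Implicit.
Unset Printing Implicit Defensive.

(** * Total computable functions *)

(** Arguments are plain lists rather than tuples, so that environments are built with [::] and
    [behead] without dependent lengths; only lists of length [n] matter. *)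
Definition recf n (F : seq nat -> nat) : Prop :=
  exists c : rec_code n, forall (v : n.-tuple nat) y, eval c v y <-> y = F v.

Notation recp n P := (recf n (fun v => nat_of_bool (P v))).

Definition recenv n m (E : seq nat -> seq nat) : Prop :=
  (forall v : n.-tuple nat, size (E v) = m) /\
  (forall i, recf n (fun v => nth 0 (E v) i)).

Lemma eq_recf n (F G : seq nat -> nat) :
  (forall v : n.-tuple nat, F v = G v) -> recf n F -> recf n G.
Proof. by move=> FG [c cP]; exists c => v y; rewrite cP FG. Qed.

Lemma recf_const n k : recf n (fun=> k).
Proof.
elim: k => [|k [c cP]]; first by exists (RZero n).
exists (RComp RSucc (fun=> c)) => v y; split=> [[w wP ->]|->].
  by have /cP := wP ord0; rewrite -/(thead w) => ->.
exists [tuple k] => [i|//]; rewrite ord1; exact/cP.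
Qed.

Lemma recf_subst n m G E : recf m G -> recenv n m E -> recf n (fun v => G (E v)).
Proof.
move=> [c cP] [szE /choice[h hP]].
exists (RComp c (fun i : 'I_m => h i)) => v y.
have tE (w : m.-tuple nat) : (forall i : 'I_m, tnth w i = nth 0 (E v) i) -> E v = w.
  move=> wE; apply: (@eq_from_nth _ 0) => [|i]; first by rewrite szE size_tuple.
  by rewrite szE => im; rewrite -(wE (Ordinal im)) (tnth_nth 0).
split=> [[w wP /cP->]|->].
  by rewrite (tE w) // => i; apply/hP/wP.
have wE i : tnth [tuple nth 0 (E v) j | j < m] i = nth 0 (E v) i.
  by rewrite tnth_mktuple.
exists [tuple nth 0 (E v) j | j < m] => [i|]; first exact/hP/wE.
by apply/cP; congr (G _); exact: tE wE.
Qed.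

Lemma recenv_id n : recenv n n id.
Proof.
split=> [v|i]; first exact: size_tuple.
have [iltn|nlei] := ltnP i n.
  by exists (RProj (Ordinal iltn)) => v y; rewrite /= (tnth_nth 0).
apply: eq_recf (recf_const n 0) => v.
by rewrite nth_default // size_tuple.
Qed.

Lemma recenv_nil n : recenv n 0 (fun=> [::]).
Proof. by split=> // i; apply: eq_recf (recf_const n 0) => v; rewrite nth_nil. Qed.

Lemma recenv_cons n m F E :
  recf n F -> recenv n m E -> recenv n m.+1 (fun v => F v :: E v).
Proof.
by move=> recF [szE recE]; split=> [v|[|i]] //=; rewrite szE.
Qed.

Lemma recenv_behead n m E : recenv n m.+1 E -> recenv n m (fun v => behead (E v)).
Proof.
move=> [szE recE]; split=> [v|i]; first by rewrite size_behead szE.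
by apply: eq_recf (recE i.+1) => v; rewrite nth_behead.
Qed.

Lemma recf_nth n m E i : recenv n m E -> recf n (fun v => nth 0 (E v) i).
Proof. by case. Qed.

Lemma recf_iteri n B G H :
  recf n B -> recf n G ->
  recf n.+2 (fun w => H (nth 0 w 0) (nth 0 w 1) (behead (behead w))) ->
  recf n (fun v => iteri (B v) (fun k r => H k r v) (G v)).
Proof.
move=> recB [g gP] [h hP].
(* [RPrec] recurses on its first argument, so the number of rounds is first an argument, and [B v]
   is substituted for it afterwards. *)
have recI : recf n.+1
    (fun w => iteri (nth 0 w 0) (fun k r => H k r (behead w)) (G (behead w))).
  have precE k (u : n.-tuple nat) y : prec_graph (eval g) (eval h) k u y <->
      y = iteri k (fun k r => H k r u) (G u).
    elim: k y => [|k IHk] y /=; first exact: gP.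
    split=> [[z /IHk-> /hP->]//|->].
    by exists (iteri k (fun k r => H k r u) (G u)); [apply/IHk | apply/hP].
  exists (RPrec g h) => v y /=.
  have -> : thead v = nth 0 v 0 by rewrite /thead (tnth_nth 0).
  exact: precE.
exact: recf_subst recI (recenv_cons recB (recenv_id n)).
Qed.


Lemma recf_succ n F : recf n F -> recf n (fun v => (F v).+1).
Proof.
move=> recF; have recS : recf 1 (fun v => (nth 0 v 0).+1).
  by exists RSucc => v y; rewrite /= /thead (tnth_nth 0).
exact: recf_subst recS (recenv_cons recF (recenv_nil n)).
Qed.

Ltac rec_env := repeat first
  [ exact: recenv_id | exact: recenv_nil | apply: recenv_behead | apply: recenv_cons
  | match goal with |- recf _ (fun v => nth 0 _ _) => apply: recf_nth end ].

Lemma recf_add n F G : recf n F -> recf n G -> recf n (fun v => F v + G v).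
Proof.
move=> recF recG.
have: recf n (fun v => iteri (F v) (fun _ r => r.+1) (G v)).
  by apply: recf_iteri => //; apply: recf_succ; rec_env.
by apply: eq_recf => v; elim: (F v) => //= k ->.
Qed.

Lemma recf_mul n F G : recf n F -> recf n G -> recf n (fun v => F v * G v).
Proof.
move=> recF recG.
have: recf n (fun v => iteri (F v) (fun _ r => G v + r) 0).
  apply: (@recf_iteri _ _ _ (fun _ r v => G v + r)) => //; first exact: recf_const.
  apply: recf_add; last by rec_env.
  by apply: recf_subst recG _; rec_env.
by apply: eq_recf => v; elim: (F v) => //= k ->.
Qed.

Lemma recf_exp n F G : recf n F -> recf n G -> recf n (fun v => F v ^ G v).
Proof.
move=> recF recG.
have: recf n (fun v => iteri (G v) (fun _ r => F v * r) 1).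
  apply: (@recf_iteri _ _ _ (fun _ r v => F v * r)) => //; first exact: recf_const.
  apply: recf_mul; last by rec_env.
  by apply: recf_subst recF _; rec_env.
by apply: eq_recf => v; elim: (G v) => //= k ->; rewrite expnS.
Qed.

Lemma recf_pred n F : recf n F -> recf n (fun v => (F v).-1).
Proof.
move=> recF.
have: recf n (fun v => iteri (F v) (fun k _ => k) 0).
  by apply: recf_iteri => //; [exact: recf_const | rec_env].
by apply: eq_recf => v; case: (F v).
Qed.

Lemma recf_sub n F G : recf n F -> recf n G -> recf n (fun v => F v - G v).
Proof.
move=> recF recG.
have: recf n (fun v => iteri (G v) (fun _ r => r.-1) (F v)).
  by apply: recf_iteri => //; apply: recf_pred; rec_env.
by apply: eq_recf => v; elim: (G v) => [|k IHk] /=; rewrite ?subn0 // IHk subnS.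
Qed.

Lemma recp_leq n F G : recf n F -> recf n G -> recp n (fun v => F v <= G v).
Proof.
move=> recF recG.
have := recf_sub (recf_const n 1) (recf_sub recF recG).
by apply: eq_recf => v; rewrite /leq; case: (F v - G v).
Qed.

Lemma recp_not n (P : seq nat -> bool) : recp n P -> recp n (fun v => ~~ P v).
Proof.
move=> recP; have := recf_sub (recf_const n 1) recP.
by apply: eq_recf => v; case: (P v).
Qed.

Lemma recp_and n (P Q : seq nat -> bool) : recp n P -> recp n Q -> recp n (fun v => P v && Q v).
Proof.
move=> recP recQ; have := recf_mul recP recQ.
by apply: eq_recf => v; rewrite mulnb.
Qed.

Lemma recp_or n (P Q : seq nat -> bool) : recp n P -> recp n Q -> recp n (fun v => P v || Q v).
Proof.
move=> recP recQ.
have := recp_not (recp_and (recp_not recP) (recp_not recQ)).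
by apply: eq_recf => v; rewrite negb_and !negbK.
Qed.

Lemma recp_implies n (P Q : seq nat -> bool) : recp n P -> recp n Q -> recp n (fun v => P v ==> Q v).
Proof.
move=> recP recQ; have := recp_or (recp_not recP) recQ.
by apply: eq_recf => v; rewrite implybE.
Qed.

Lemma recp_eq n F G : recf n F -> recf n G -> recp n (fun v => F v == G v).
Proof.
move=> recF recG; have := recp_and (recp_leq recF recG) (recp_leq recG recF).
by apply: eq_recf => v; rewrite eqn_leq.
Qed.

Lemma recf_if n (P : seq nat -> bool) F G :
  recp n P -> recf n F -> recf n G -> recf n (fun v => if P v then F v else G v).
Proof.
move=> recP recF recG.
have := recf_add (recf_mul recP recF) (recf_mul (recp_not recP) recG).
by apply: eq_recf => v; case: (P v); rewrite /= !mul1n ?mul0n ?addn0.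
Qed.

Lemma recp_all n B (P : nat -> seq nat -> bool) :
  recf n B -> recp n.+1 (fun w => P (nth 0 w 0) (behead w)) ->
  recp n (fun v => all (fun k => P k v) (iota 0 (B v))).
Proof.
move=> recB recP.
have: recf n (fun v => iteri (B v) (fun k r => r * P k v) 1).
  apply: (@recf_iteri _ _ _ (fun k r v => r * P k v)) => //; first exact: recf_const.
  apply: recf_mul; first by rec_env.
  apply: (@recf_subst _ _ (fun w => nat_of_bool (P (nth 0 w 0) (behead w)))
            (fun w => nth 0 w 0 :: behead (behead w)) recP).
  by rec_env.
apply: eq_recf => v; elim: (B v) => // k IHk.
by rewrite iteriS IHk -addn1 iotaD all_cat /= andbT mulnb.
Qed.

Lemma recp_has n B (P : nat -> seq nat -> bool) :
  recf n B -> recp n.+1 (fun w => P (nth 0 w 0) (behead w)) ->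
  recp n (fun v => has (fun k => P k v) (iota 0 (B v))).
Proof.
move=> recB recP; have := recp_not (recp_all (P := fun k v => ~~ P k v) recB (recp_not recP)).
by apply: eq_recf => v; rewrite -has_predC; congr nat_of_bool; apply: eq_has => k /=;
  rewrite negbK.
Qed.

Lemma recf_find n B (P : nat -> seq nat -> bool) :
  recf n B -> recp n.+1 (fun w => P (nth 0 w 0) (behead w)) ->
  recf n (fun v => find (fun k => P k v) (iota 0 (B v))).
Proof.
move=> recB recP.
(* The accumulator equals the counter up to the first [k] with [P k v] and stays at that [k] from
   then on. *)
have: recf n (fun v => iteri (B v) (fun k r => r + ((r == k) && ~~ P k v)) 0).
  apply: (@recf_iteri _ _ _ (fun k r v => r + ((r == k) && ~~ P k v))) => //.
    exact: recf_const.
  apply: recf_add; first by rec_env.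
  apply: recp_and; first by apply: recp_eq; rec_env.
  apply: recp_not.
  apply: (@recf_subst _ _ (fun w => nat_of_bool (P (nth 0 w 0) (behead w)))
            (fun w => nth 0 w 0 :: behead (behead w)) recP).
  by rec_env.
apply: eq_recf => v; elim: (B v) => // k IHk.
rewrite iteriS IHk -addn1 iotaD find_cat add0n size_iota.
case: ifP => [|/negbT/hasNfind->].
  by rewrite has_find size_iota => /ltn_eqF->; rewrite addn0.
by rewrite size_iota eqxx /=; case: (P k v).
Qed.

Lemma recf_least n (P : nat -> seq nat -> bool) (M : seq nat -> nat) :
  recp n.+1 (fun w => P (nth 0 w 0) (behead w)) ->
  (forall v : n.-tuple nat, P (M v) v /\ forall k, k < M v -> ~~ P k v) ->
  recf n M.
Proof.
move=> /recp_not[c cP] MP; exists (RMu c) => v y /=; have [PM minM] := MP v.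
split=> [[/cP/= /esym/eqP]|->].
  rewrite eqb0 negbK => Py before.
  case: (ltngtP y (M v)) => // [/minM|ltMy]; first by rewrite Py.
  by have [z /cP/=] := before _ ltMy; rewrite PM.
split=> [|k /minM NPk]; first by apply/cP; rewrite /= PM.
by exists 0; apply/cP; rewrite /= NPk.
Qed.

Lemma recf_comp1 n (g : nat -> nat) F :
  recf 1 (fun v => g (nth 0 v 0)) -> recf n F -> recf n (fun v => g (F v)).
Proof.
by move=> recg recF; exact: recf_subst recg (recenv_cons recF (recenv_nil n)).
Qed.

Lemma recf_comp2 n (g : nat -> nat -> nat) F G :
  recf 2 (fun v => g (nth 0 v 0) (nth 0 v 1)) -> recf n F -> recf n G ->
  recf n (fun v => g (F v) (G v)).
Proof.
move=> recg recF recG.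
exact: recf_subst recg (recenv_cons recF (recenv_cons recG (recenv_nil n))).
Qed.

Ltac rec_step := first
  [ assumption | exact: recf_const
  | match goal with
    | |- recf _ (fun v => nth 0 _ _) => by apply: recf_nth; rec_env
    | |- recf _ (fun v => (@?F v).+1) => apply: recf_succ
    | |- recf _ (fun v => @?F v + @?G v) => apply: recf_add
    | |- recf _ (fun v => @?F v * @?G v) => apply: recf_mul
    | |- recf _ (fun v => @?F v ^ @?G v) => apply: recf_exp
    | |- recf _ (fun v => nat_of_bool (@?F v <= @?G v)) => apply: recp_leq
    | |- recf _ (fun v => nat_of_bool (@?F v == @?G v)) => apply: recp_eq
    | |- recf _ (fun v => nat_of_bool (~~ (@?F v))) => apply: recp_not
    | |- recf _ (fun v => nat_of_bool (@?F v && @?G v)) => apply: recp_and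
    | |- recf _ (fun v => nat_of_bool (@?F v ==> @?G v)) => apply: recp_implies
    | |- recf _ (fun v => nat_of_bool (all (@?P v) (iota 0 (@?B v)))) =>
        apply: recp_all
    | |- recf _ (fun v => nat_of_bool (has (@?P v) (iota 0 (@?B v)))) =>
        apply: recp_has
    | |- recf _ (fun v => find (@?P v) (iota 0 (@?B v))) => apply: recf_find
    end ].
Ltac rec_tac := repeat rec_step.

Lemma find_iota (P : pred nat) n k :
  P k -> (forall i, i < k -> ~~ P i) -> k < n -> find P (iota 0 n) = k.
Proof.
move=> Pk minP kn; have hasP : has P (iota 0 n).
  by apply/hasP; exists k; rewrite // mem_iota.
have ltn : find P (iota 0 n) < n by rewrite -[X in _ < X](size_iota 0 n) -has_find.
have := nth_find 0 hasP; rewrite nth_iota // => Pf.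
case: (ltngtP (find P (iota 0 n)) k) => // [/minP|lt]; first by rewrite Pf.
by have := before_find 0 lt; rewrite nth_iota // add0n Pk.
Qed.

(** * Computability of head, tail and membership for coded lists *)

Lemma code_cons h t : CodeSeq.code (h :: t) = 2 ^ h * (CodeSeq.code t).*2.+1.
Proof. by []. Qed.

Lemma code_head_unique h s i t :
  CodeSeq.code (h :: s) = 2 ^ i * t.*2.+1 -> i = h /\ t = CodeSeq.code s.
Proof.
rewrite -[t]CodeSeq.decodeK -code_cons => /(can_inj CodeSeq.codeK)[-> ->].
by [].
Qed.

Lemma code_bounds h s : h < CodeSeq.code (h :: s) /\ CodeSeq.code s < CodeSeq.code (h :: s).
Proof.
rewrite code_cons; have hlt := ltn_expl h (ltnSn 1).
move: (CodeSeq.code s) (2 ^ h) hlt => c e hlt; split; nia.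
Qed.

(** For [l > 0] the head is the unique [i] with [l = 2 ^ i * t.*2.+1] for some [t]; both [i] and [t]
    are below [l], so a bounded search finds it. For [l = 0], the empty list, the range is empty and
    [find] returns the default head [0]. *)
Lemma recf_head n F : recf n F -> recf n (fun v => head 0 (CodeSeq.decode (F v))).
Proof.
apply: (@recf_comp1 _ (fun l => head 0 (CodeSeq.decode l))).
have: recf 1 (fun v => find (fun i => has (fun t => nth 0 v 0 == 2 ^ i * (t + t).+1)
          (iota 0 (nth 0 v 0))) (iota 0 (nth 0 v 0))).
  apply: (@recf_find _ _ (fun i v => has (fun t => nth 0 v 0 == 2 ^ i * (t + t).+1)
          (iota 0 (nth 0 v 0)))); first by rec_tac.
  by apply: (@recp_has _ _ (fun t w => nth 0 (behead w) 0 == 2 ^ (nth 0 w 0) * (t + t).+1));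
    rec_tac.
apply: eq_recf => v; move: (nth 0 v 0) => l; rewrite -[l]CodeSeq.decodeK.
case: (CodeSeq.decode l) => // h s; rewrite CodeSeq.codeK /=.
have [lth lts] := code_bounds h s.
apply: find_iota => // [|i lti]; last first.
  apply/hasPn => t _; apply/eqP; rewrite addnn => /code_head_unique[ih _].
  by rewrite ih ltnn in lti.
by apply/hasP; exists (CodeSeq.code s); rewrite ?mem_iota // addnn.
Qed.

Lemma recf_tail n F :
  recf n F -> recf n (fun v => CodeSeq.code (behead (CodeSeq.decode (F v)))).
Proof.
apply: (@recf_comp1 _ (fun l => CodeSeq.code (behead (CodeSeq.decode l)))).
have: recf 1 (fun v => find
    (fun t => nth 0 v 0 == 2 ^ head 0 (CodeSeq.decode (nth 0 v 0)) * (t + t).+1)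
    (iota 0 (nth 0 v 0))).
  apply: (@recf_find _ _ (fun t v =>
    nth 0 v 0 == 2 ^ head 0 (CodeSeq.decode (nth 0 v 0)) * (t + t).+1)); rec_tac.
  by apply: recf_head; rec_tac.
apply: eq_recf => v; move: (nth 0 v 0) => l; rewrite -[l]CodeSeq.decodeK.
case: (CodeSeq.decode l) => // h s; rewrite CodeSeq.codeK /=.
have [_ lts] := code_bounds h s.
apply: find_iota => // [|t ltt]; first by rewrite addnn.
apply/eqP; rewrite addnn => /code_head_unique[_ ts].
by rewrite ts ltnn in ltt.
Qed.

Lemma recf_drop n F G : recf n F -> recf n G ->
  recf n (fun v => CodeSeq.code (drop (G v) (CodeSeq.decode (F v)))).
Proof.
apply: (@recf_comp2 _ (fun l k => CodeSeq.code (drop k (CodeSeq.decode l)))).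
have: recf 2 (fun v => iteri (nth 0 v 1)
    (fun _ l => CodeSeq.code (behead (CodeSeq.decode l))) (nth 0 v 0)).
  by apply: recf_iteri; rec_tac; apply: recf_tail; rec_tac.
apply: eq_recf => v; elim: (nth 0 v 1) => [|k IHk].
  by rewrite drop0 CodeSeq.decodeK.
by rewrite iteriS IHk CodeSeq.codeK -drop1 drop_drop.
Qed.

Lemma recf_nth_decode n F G : recf n F -> recf n G ->
  recf n (fun v => nth 0 (CodeSeq.decode (F v)) (G v)).
Proof.
move=> recF recG; have := recf_head (recf_drop recF recG).
by apply: eq_recf => v; rewrite CodeSeq.codeK -nth0 nth_drop addn0.
Qed.

Lemma recp_mem_decode n F G : recf n F -> recf n G ->
  recp n (fun v => F v \in CodeSeq.decode (G v)).
Proof.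
apply: (@recf_comp2 _ (fun u l => u \in CodeSeq.decode l)).
(* A nonzero code of [drop i _] says that [i] is a valid position, which excludes the default value
   of [nth]. *)
have: recp 2 (fun v => has (fun i => (1 <= CodeSeq.code (drop i (CodeSeq.decode (nth 0 v 1))))
    && (nth 0 (CodeSeq.decode (nth 0 v 1)) i == nth 0 v 0)) (iota 0 (nth 0 v 1))).
  apply: (@recp_has _ _ (fun i v => (1 <= CodeSeq.code (drop i (CodeSeq.decode (nth 0 v 1))))
    && (nth 0 (CodeSeq.decode (nth 0 v 1)) i == nth 0 v 0))); rec_tac.
    by apply: recf_drop; rec_tac.
  by apply: recf_nth_decode; rec_tac.
have code0 s : (0 < CodeSeq.code s) = (0 < size s).
  by case: s => //= h s; rewrite muln_gt0 expn_gt0.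
apply: eq_recf => v; move: (nth 0 v 0) (nth 0 v 1) => u l; congr nat_of_bool.
apply/hasP/idP => [[i _ /andP[]]|].
  by rewrite code0 size_drop subn_gt0 => lti /eqP<-; exact: mem_nth.
move=> ul; have ltu : index u (CodeSeq.decode l) < size (CodeSeq.decode l).
  by rewrite index_mem.
exists (index u (CodeSeq.decode l)).
  rewrite mem_iota /= add0n (leq_trans ltu) // -[X in _ <= X]CodeSeq.decodeK.
  elim: (CodeSeq.decode l) => // h s IHs; apply: leq_ltn_trans IHs _.
  by case: (code_bounds h s).
by rewrite code0 size_drop subn_gt0 ltu nth_index /=.
Qed.

(** * Evaluation with a step bound *)

Local Arguments iteri : simpl never.

(* [run c s v] is [y.+1] if the computation of [c] on [v], with all its
   unbounded searches cut at [s], returns [y], and [0] if it fails. *)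
Fixpoint run n (c : rec_code n) (s : nat) (v : seq nat) {struct c} : nat :=
  match c with
  | RZero _ => 1
  | RSucc => (nth 0 v 0).+2
  | RProj _ i => (nth 0 v i).+1
  | RComp m _ g h =>
      let ws := [seq run (h i) s v | i <- enum 'I_m] in
      if all (leq 1) ws then run g s [seq w.-1 | w <- ws] else 0
  | RPrec _ g h =>
      iteri (nth 0 v 0)
        (fun k r => if 0 < r then run h s [:: k, r.-1 & behead v] else 0)
        (run g s (behead v))
  | RMu _ g =>
      let y := find (fun k => run g s (k :: v) <= 1) (iota 0 s) in
      if (y < s) && (run g s (y :: v) == 1) then y.+1 else 0
  end.

Lemma recenv_map_ord n m (F : 'I_m -> seq nat -> nat) :
  (forall i, recf n (F i)) -> recenv n m (fun v => [seq F i v | i <- enum 'I_m]).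
Proof.
move=> recF; split=> [v|i]; first by rewrite size_map size_enum_ord.
have [im|mi] := ltnP i m.
  apply: eq_recf (recF (Ordinal im)) => v.
  by rewrite (nth_map (Ordinal im)) ?size_enum_ord // (nth_ord_enum _ (Ordinal im)).
apply: eq_recf (recf_const n 0) => v.
by rewrite nth_default // size_map size_enum_ord.
Qed.

Lemma recp_all_seq n (I : Type) (r : seq I) (P : I -> seq nat -> bool) :
  (forall i, recp n (P i)) -> recp n (fun v => all (fun i => P i v) r).
Proof.
move=> recP; elim: r => [|i r IHr] /=; first exact: recf_const.
exact: recp_and.
Qed.

(** The step bound becomes the first argument. As [c] is fixed, induction on it does the work of a
    universal machine. *)
Lemma recf_run n (c : rec_code n) :
  recf n.+1 (fun w => run c (nth 0 w 0) (behead w)).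
Proof.
elim: n / c => [n||n i|m n g IHg h IHh|n g IHg h IHh|n g IHg] /=.
- exact: recf_const.
- by rec_tac.
- by rec_tac.
- apply: recf_if; last exact: recf_const.
    have := @recp_all_seq n.+1 _ (enum 'I_m)
      (fun i w => 0 < run (h i) (nth 0 w 0) (behead w)).
    move=> /(_ (fun i => recp_leq (recf_const _ 1) (IHh i))).
    by apply: eq_recf => v; rewrite all_map.
  apply: (@recf_subst _ _ (fun w => run g (nth 0 w 0) (behead w))
    (fun w => nth 0 w 0 :: [seq x.-1 | x <- [seq run (h i) (nth 0 w 0) (behead w)
                                            | i <- enum 'I_m]]) IHg).
  apply: recenv_cons; first by rec_tac.
  have := @recenv_map_ord n.+1 m
    (fun i w => (run (h i) (nth 0 w 0) (behead w)).-1) (fun i => recf_pred (IHh i)).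
  by congr recenv; apply/funext => w; rewrite -map_comp.
- apply: (@recf_iteri _ _ _ (fun k r w =>
    if 0 < r then run h (nth 0 w 0) [:: k, r.-1 & behead (behead w)] else 0)).
  + by rec_tac.
  + apply: (@recf_subst _ _ _ (fun w => nth 0 w 0 :: behead (behead w)) IHg).
    by rec_env.
  + apply: recf_if; [by rec_tac| |exact: recf_const].
    apply: (@recf_subst _ _ _ (fun w =>
      [:: nth 0 (behead (behead w)) 0, nth 0 w 0, (nth 0 w 1).-1 &
        behead (behead (behead (behead w)))]) IHh).
    by rec_env; apply: recf_pred; rec_tac.
- have recG : recf n.+2 (fun w => run g (nth 0 (behead w) 0)
      (nth 0 w 0 :: behead (behead w))).
    apply: (@recf_subst _ _ _ (fun w =>
      [:: nth 0 (behead w) 0, nth 0 w 0 & behead (behead w)]) IHg).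
    by rec_env.
  have recY : recf n.+1 (fun w => find
      (fun k => run g (nth 0 w 0) (k :: behead w) <= 1) (iota 0 (nth 0 w 0))).
    apply: (@recf_find _ _ (fun k w => run g (nth 0 w 0) (k :: behead w) <= 1)).
      by rec_tac.
    by rec_tac.
  apply: recf_if; [|exact: recf_succ|exact: recf_const].
  apply: recp_and; first by apply: recp_leq; [exact: recf_succ|rec_tac].
  apply: recp_eq; last exact: recf_const.
  apply: (@recf_subst _ _ (fun w => run g (nth 0 (behead w) 0) (nth 0 w 0 :: behead (behead w)))
    (fun w => find (fun k => run g (nth 0 w 0) (k :: behead w) <= 1)
                (iota 0 (nth 0 w 0)) :: w) recG).
  exact: recenv_cons recY (recenv_id _).
Qed.

Lemma run_mono n (c : rec_code n) s s' v y :
  s <= s' -> run c s v = y.+1 -> run c s' v = y.+1.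
Proof.
move=> les; elim: n / c v y => [n||n i|m n g IHg h IHh|n g IHg h IHh|n g IHg] v y //=.
- case: ifP => // /allP hs.
  have hE : [seq run (h i) s' v | i <- enum 'I_m] = [seq run (h i) s v | i <- enum 'I_m].
    apply: eq_map => i; have := hs _ (map_f _ (mem_enum _ i)).
    case E: (run (h i) s v) => [|z] // _; exact: IHh E.
  by rewrite hE; move/allP: hs => ->; exact: IHg.
- elim: (nth 0 v 0) y => [|k IHk] y /=; first exact: IHg.
  rewrite !iteriS; case: ifP => //.
  by case E: (iteri k _ _) => [|r] // _; rewrite (IHk _ E) /=; exact: IHh.
- set P := fun k => _; set P' := fun k => run g s' _ <= 1.
  case: ifP => // /andP[lty /eqP runy] [yE]; rewrite yE in lty runy.
  (* Below [y] every run exceeds [1], i.e. returns a nonzero value; a larger bound keeps these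
     values, so the search still stops at [y]. *)
  have before k : k < y -> ~~ P k.
    move=> ky; rewrite -yE in ky.
    have := before_find 0 ky; rewrite nth_iota ?add0n; last first.
      by apply: leq_trans ky _; rewrite -[X in _ <= X](size_iota 0 s) find_size.
    by move=> ->.
  have -> : find P' (iota 0 s') = y.
    apply: find_iota; [by rewrite /P' (IHg _ _ runy)| |exact: leq_trans les].
    move=> k /before; rewrite /P /P' -!ltnNge.
    by case E: (run g s (k :: v)) => [|[|z]] // _; rewrite (IHg _ _ E).
  by rewrite (leq_trans lty les) (IHg _ _ runy).
Qed.

Lemma run_sound n (c : rec_code n) s (v : n.-tuple nat) y :
  run c s v = y.+1 -> eval c v y.
Proof.
elim: n / c v y => [n||n i|m n g IHg h IHh|n g IHg h IHh|n g IHg] v y /=.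
- by case.
- by move=> [<-]; rewrite /thead (tnth_nth 0).
- by move=> [<-]; rewrite (tnth_nth 0).
- case: ifP => // /allP hs runy.
  exists [tuple (run (h i) s v).-1 | i < m] => [i|].
    rewrite tnth_mktuple; apply: IHh.
    by have := hs _ (map_f _ (mem_enum _ i)); case: (run (h i) s v).
  apply: IHg; rewrite -runy; congr run; rewrite -map_comp.
  by rewrite /= -map_comp.
- have -> : thead v = nth 0 v 0 by rewrite /thead (tnth_nth 0).
  have uE : behead v = [tuple of behead v] by [].
  move: [tuple of behead v] uE => u ->; elim: (nth 0 v 0) y => [|k IHk] y /=.
    exact: IHg.
  rewrite iteriS; case: ifP => //; case E: (iteri k _ _) => [|r] // _ runy.
  exists r; first exact: IHk.
  exact: (IHh [tuple of k :: r :: u]).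
- set P := fun k => _; case: ifP => // /andP[lty /eqP runy] [yE].
  rewrite yE in lty runy; split; first exact: (IHg [tuple of y :: v]).
  move=> k ky; rewrite -yE in ky.
  have := before_find 0 ky; rewrite nth_iota ?add0n; last first.
    by apply: leq_trans ky _; rewrite -[X in _ <= X](size_iota 0 s) find_size.
  rewrite /P; case E: (run g s (k :: v)) => [|[|z]] // _.
  by exists z; apply: (IHg [tuple of k :: v]).
Qed.

(** By monotonicity the maximum of the individual bounds works; this lets finitely many
    subcomputations finish under one step bound. *)
Lemma uniform_bound (Q : nat -> nat -> Prop) m :
  (forall i s s', s <= s' -> Q i s -> Q i s') ->
  (forall i, i < m -> exists s, Q i s) -> exists s, forall i, i < m -> Q i s.
Proof.
move=> Qmono; elim: m => [|m IHm] Qex; first by exists 0.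
have [|s Qs] := IHm; first by move=> i im; apply: Qex; exact: ltnW.
have [s' Qs'] := Qex _ (ltnSn m); exists (maxn s s') => i.
rewrite ltnS leq_eqVlt => /predU1P[->|im].
  exact: Qmono (leq_maxr _ _) Qs'.
exact: Qmono (leq_maxl _ _) (Qs _ im).
Qed.

Lemma run_complete n (c : rec_code n) (v : n.-tuple nat) y :
  eval c v y -> exists s, run c s v = y.+1.
Proof.
elim: n / c v y => [n||n i|m n g IHg h IHh|n g IHg h IHh|n g IHg] v y /=.
- by move=> ->; exists 0.
- by move=> ->; exists 0; rewrite /thead (tnth_nth 0).
- by move=> ->; exists 0; rewrite (tnth_nth 0).
- move=> [w hw /IHg[s sP]].
  pose Q i s := forall im : i < m,
    run (h (Ordinal im)) s v = (nth 0 w i).+1.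
  have [i a b ab Qa im|i im|s' s'P] := @uniform_bound Q m.
  + exact: run_mono ab (Qa im).
  + have [t tP] := IHh _ _ _ (hw (Ordinal im)).
    exists t => im'; rewrite (bool_irrelevance im' im) tP.
    by rewrite (tnth_nth 0).
  exists (maxn s s').
  have hE : [seq run (h i) (maxn s s') v | i <- enum 'I_m] = [seq x.+1 | x <- w].
    apply: (@eq_from_nth _ 0) => [|i]; first by rewrite size_map size_enum_ord size_map size_tuple.
    rewrite size_map size_enum_ord => im.
    rewrite (nth_map (Ordinal im)) ?size_enum_ord // (nth_ord_enum _ (Ordinal im)).
    rewrite (nth_map 0) ?size_tuple //; apply: run_mono (leq_maxr _ _) _.
    exact: s'P.
  rewrite hE all_map (eq_all (a2 := predT)) // all_predT -map_comp map_id.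
  exact: run_mono (leq_maxl _ _) sP.
- have -> : thead v = nth 0 v 0 by rewrite /thead (tnth_nth 0).
  have uE : behead v = [tuple of behead v] by [].
  move: [tuple of behead v] uE => u ->; elim: (nth 0 v 0) y => [|k IHk] y /=.
    exact: IHg.
  move=> [z /IHk[s sP] /IHh[t tP]]; exists (maxn s t).
  (* The iterate after [k] rounds is itself the run of [RPrec g h] on [k :: u]. *)
  have := @run_mono _ (RPrec g h) s (maxn s t) (k :: u) z (leq_maxl _ _).
  rewrite /= => /(_ sP); rewrite iteriS => -> /=.
  exact: run_mono (leq_maxr _ _) tP.
- move=> [/IHg[s sP] before].
  pose Q i s := exists z, run g s (i :: v) = z.+2.
  have [i a b ab [z zP]|i iy|s' s'P] := @uniform_bound Q y.
  + by exists z; exact: run_mono zP.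
  + by have [z /IHg[t tP]] := before _ iy; exists t, z.
  set b := maxn (maxn s s') y.+1; exists b.
  have runy : run g b (y :: v) = 1.
    by apply: run_mono sP; rewrite /b -maxnA leq_maxl.
  have yb : y < b by rewrite leq_maxr.
  have -> : find (fun k => run g b (k :: v) <= 1) (iota 0 b) = y.
    apply: find_iota; rewrite ?runy // => k /s'P[z zP].
    by rewrite (run_mono _ zP) // /b (maxnC s) -maxnA leq_maxl.
  by rewrite yb runy.
Qed.

Lemma eval_functional n (c : rec_code n) v y y' : eval c v y -> eval c v y' -> y = y'.
Proof.
move=> /run_complete[s sP] /run_complete[s' s'P].
have := run_mono (leq_maxl s s') sP.
by rewrite (run_mono (leq_maxr s s') s'P) => -[].
Qed.

(** * Numberings *)

Lemma eval_comp2 n (g : rec_code 2) (a b : rec_code n) v y :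
  eval (RComp g (tnth [tuple a; b])) v y <->
  exists s t, [/\ eval a v s, eval b v t & eval g [tuple s; t] y].
Proof.
split=> /= [[w hw gy]|[s [t [sP tP gy]]]].
  exists (tnth w ord0), (tnth w (lift ord0 ord0)); split.
  - exact: (hw ord0).
  - exact: (hw (lift ord0 ord0)).
  - suff -> : [tuple tnth w ord0; tnth w (lift ord0 ord0)] = w by [].
    by apply/val_inj; case: w {hw gy} => -[|i [|j [|? ?]]].
exists [tuple s; t] => // i.
by case: i => -[|[|//]] lti; rewrite !(tnth_nth s) (tnth_nth a).
Qed.

Lemma numbering_of_code (c : rec_code 2) : exists psi, numbering psi /\
  forall e x y, psi e x = Some y <-> eval c [tuple e; x] y.
Proof.
pose psi e x := if pselect (exists y, eval c [tuple e; x] y) is left ex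
  then Some (projT1 (cid ex)) else None.
have psiP e x y : psi e x = Some y <-> eval c [tuple e; x] y.
  rewrite /psi; case: pselect => [ex|nex]; last by split=> // ey; case: nex; exists y.
  case: (cid ex) => z /= zP; split=> [[<-] //|yP]; congr Some.
  exact: eval_functional zP yP.
exists psi; split=> //; exists c => v y; rewrite psiP.
suff -> : [tuple tnth v ord0; tnth v ord_max] = v by [].
by apply/val_inj; case: v => -[|a [|b [|? ?]]] // sz.
Qed.

Lemma numbering_code phi : numbering phi ->
  exists c : rec_code 2, forall e x y, eval c [tuple e; x] y <-> phi e x = Some y.
Proof.
by move=> [c cP]; exists c => e x y; rewrite -cP !(tnth_nth 0).
Qed.

(** [psi p] searches for the least [z] with [Q p z], then simulates [phi (G p z)]. With the
    Kolmogorov property, functions found by search thus get indices linear in [p]. *)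
Lemma search_numbering phi (Q : nat -> nat -> bool) (G : nat -> nat -> nat) :
  numbering phi -> recp 2 (fun v => Q (nth 0 v 0) (nth 0 v 1)) ->
  recf 2 (fun v => G (nth 0 v 0) (nth 0 v 1)) ->
  exists psi, numbering psi /\
    forall p z, Q p z -> (forall z', Q p z' -> z <= z') -> psi p =1 phi (G p z).
Proof.
move=> /numbering_code[cphi cphiP] recQ [cG cGP].
have /recp_not[cQ cQP] : recp 3 (fun w => Q (nth 0 w 1) (nth 0 w 0)).
  by apply: (@recf_comp2 _ (fun a b => nat_of_bool (Q a b))) => //; rec_tac.
pose c := RComp cphi (tnth [tuple
  RComp cG (tnth [tuple RProj ord0; RMu cQ]); RProj (lift ord0 ord0)]).
have [psi [psi_num psiP]] := numbering_of_code c.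
exists psi; split=> // p z Qz minz x.
have muE t : eval (RMu cQ) [tuple p; x] t <-> t = z.
  split=> [[/cQP/= /esym/eqP]|->].
    rewrite eqb0 negbK => Qt before; case: (ltngtP t z) => // [|zt].
      by rewrite ltnNge minz.
    by have [k /cQP/=] := before _ zt; rewrite Qz.
  split=> [|k kz]; first by apply/cQP; rewrite /= Qz.
  exists 0; apply/cQP => /=; case Qk: (Q p k) => //.
  by have := minz _ Qk; rewrite leqNgt kz.
have psiE y : psi p x = Some y <-> phi (G p z) x = Some y.
  rewrite psiP -cphiP; split.
    move=> /eval_comp2[s [t [/eval_comp2[a [b [/= -> /muE-> /cGP->]]] -> ]]].
    by rewrite /= !(tnth_nth 0).
  move=> phiy; apply/eval_comp2; exists (G p z), x; split=> //.
  apply/eval_comp2; exists p, z; split=> //; first exact/muE.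
  exact/cGP.
case psiy: (psi p x) => [y|]; first by move/psiE: psiy.
case phiy: (phi (G p z) x) => [y|] //.
by move/psiE: phiy; rewrite psiy.
Qed.

(* Dovetailing finds, uniformly in [e], an index of some function with value [e]
   at [0]; the Kolmogorov property, applied to the constant functions, ensures
   that one exists below a linear bound. *)
Lemma separated_indices phi : numbering phi -> kolmogorov_property phi ->
  exists c X, [/\ 0 < c, recf 1 (fun v => X (nth 0 v 0)),
    forall e, X e <= c * e + c & forall e, phi (X e) 0 = Some e].
Proof.
move=> /numbering_code[cphi cphiP] kphi.
(* The first projection numbers the constant functions. *)
have [psi [psi_num psiP]] := numbering_of_code (RProj ord0).
have [c [c0 [t tP]]] := kphi _ psi_num.
(* [z] codes an index and a step bound that witnesses its value at [0]. *)
pose P e z := (nth 0 (CodeSeq.decode z) 0 <= c * e + c) &&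
  (run cphi (nth 0 (CodeSeq.decode z) 1) [:: nth 0 (CodeSeq.decode z) 0; 0] == e.+1).
have exP e : exists z, P e z.
  have [te psit] := tP e.
  have /cphiP/run_complete[s sP] : phi (t e) 0 = Some e by rewrite psit; apply/psiP.
  by exists (CodeSeq.code [:: t e; s]); rewrite /P CodeSeq.codeK /= te sP /=.
exists c, (fun e => nth 0 (CodeSeq.decode (ex_minn (exP e))) 0); split=> // [|e|e].
- apply: recf_nth_decode; last exact: recf_const.
  apply: (@recf_least _ (fun z v => P (nth 0 v 0) z)); last first.
    move=> v; case: ex_minnP => z Pz minz; split=> // k kz.
    by apply/negP => /minz; rewrite leqNgt kz.
  apply: recp_and; first by rec_tac; apply: recf_nth_decode; rec_tac.
  apply: recp_eq; last by rec_tac.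
  apply: (@recf_subst _ _ _ (fun w => [:: nth 0 (CodeSeq.decode (nth 0 w 0)) 1;
    nth 0 (CodeSeq.decode (nth 0 w 0)) 0; 0]) (recf_run cphi)).
  by apply: recenv_cons; [|apply: recenv_cons; [|rec_env; rec_tac]];
    apply: recf_nth_decode; rec_tac.
- by case: ex_minnP => z /andP[].
- case: ex_minnP => z /andP[_ /eqP runz] _; apply/cphiP.
  exact: (run_sound (v := [tuple nth 0 (CodeSeq.decode z) 0; 0])) runz.
Qed.

Ltac rec_list_step := first
  [ rec_step
  | match goal with
    | |- recf _ (fun v => head 0 (CodeSeq.decode _)) => apply: recf_head
    | |- recf _ (fun v => CodeSeq.code (behead (CodeSeq.decode _))) => apply: recf_tail
    | |- recf _ (fun v => nth 0 (CodeSeq.decode _) _) => apply: recf_nth_decode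
    | |- recf _ (fun v => nat_of_bool (_ \in CodeSeq.decode _)) => apply: recp_mem_decode
    end ].
Ltac rec_list_tac := repeat rec_list_step.

(** * Small covers are impossible *)

Section SmallCover.
Variables (phi : nat -> nat -> option nat) (f : nat -> seq nat) (X : nat -> nat).
Hypothesis phi_num : numbering phi.
Hypothesis phi_kol : kolmogorov_property phi.
Hypothesis f_comp : computable_to_lists f.
Hypothesis f_min : forall x, min_index phi x \in f x.
Hypothesis X_comp : recf 1 (fun v => X (nth 0 v 0)).
Hypothesis X_sep : forall e, phi (X e) 0 = Some e.

(* In the list [s], the entries at positions [m, ..., 2m - 1] are distinct
   numbers [e] and those at positions below [m/2] contain all the elements of
   the lists [f (X e)] between [m/4] and [n m]. *)
Definition covering (n m : nat) (s : seq nat) : bool :=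
  all (fun i => all (fun j => (m <= j) ==> ~~ (nth 0 s i == nth 0 s j)) (iota 0 i))
    (iota 0 (m + m)) &&
  all (fun i => (m <= i) ==> all (fun u =>
      ((m <= 4 * u) && (u \in f (X (nth 0 s i)))) ==>
      has (fun j => (j + j < m) && (nth 0 s j == u)) (iota 0 m))
    (iota 0 (n * m))) (iota 0 (m + m)).

Lemma recf_code_f : recf 1 (fun v => CodeSeq.code (f (nth 0 v 0))).
Proof.
have [c cP] := f_comp; exists c => v y; rewrite -cP /thead (tnth_nth 0).
by split=> [[->]|->].
Qed.

Lemma recp_covering :
  recp 3 (fun v => covering (nth 0 v 0) (nth 0 v 1) (CodeSeq.decode (nth 0 v 2))).
Proof.
have recM : recp 2 (fun v => nth 0 v 0 \in f (X (nth 0 v 1))).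
  have recF : recf 2 (fun v => CodeSeq.code (f (X (nth 0 v 1)))).
    apply: (recf_comp1 (g := fun x => CodeSeq.code (f x)) recf_code_f).
    by apply: (recf_comp1 (g := X)) => //; rec_tac.
  have recU : recf 2 (fun v => nth 0 v 0) by rec_tac.
  by have := recp_mem_decode recU recF; apply: eq_recf => v; rewrite CodeSeq.codeK.
rewrite /covering; rec_list_tac.
by apply: (recf_comp2 (g := fun u e => nat_of_bool (u \in f (X e))) recM); rec_list_tac.
Qed.

(* This pairing is linear in [J] for each fixed [b]. *)
Definition index_of b J : nat := 2 ^ b * J.*2.+1.
(** [index_of b J] is the code of the list with head [b] whose tail has code [J], so head and tail
    recover the two components. *)
Definition ipart p := head 0 (CodeSeq.decode p).
Definition jpart p := CodeSeq.code (behead (CodeSeq.decode p)).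
(** Recovers [m = 2 ^ k] from any [J] in [[m, 2m)], so that [J] alone carries both the size [m] and
    a position in the list. *)
Definition pow2_below J := 2 ^ find (fun i => J.+1 <= 2 ^ i.+1) (iota 0 J).

Lemma ipartK b J : ipart (index_of b J) = b.
Proof. by rewrite /ipart /index_of -[J]CodeSeq.decodeK -code_cons CodeSeq.codeK. Qed.

Lemma jpartK b J : jpart (index_of b J) = J.
Proof.
by rewrite /jpart /index_of -[J]CodeSeq.decodeK -code_cons CodeSeq.codeK.
Qed.

Lemma pow2_belowE k J : 2 ^ k <= J < 2 ^ k + 2 ^ k -> pow2_below J = 2 ^ k.
Proof.
move=> /andP[leJ ltJ]; rewrite /pow2_below; congr expn; apply: find_iota.
- by rewrite expnS mul2n -addnn.
- by move=> i ik; rewrite -ltnNge ltnS (leq_trans _ leJ) // leq_exp2l.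
- exact: leq_trans (ltn_expl k (ltnSn 1)) leJ.
Qed.

Lemma covering_unbounded : exists b, forall k s, 1 < k ->
  ~~ covering (2 ^ (b + b).+2) (2 ^ k) s.
Proof.
(* [ipart p] is a guess for the Kolmogorov constant of the numbering under construction. *)
pose Q p z := covering (2 ^ (ipart p + ipart p).+2) (pow2_below (jpart p)) (CodeSeq.decode z).
pose G p z := X (nth 0 (CodeSeq.decode z) (jpart p)).
have recQ : recp 2 (fun v => Q (nth 0 v 0) (nth 0 v 1)).
  apply: (@recf_subst _ _ _ (fun v => [:: 2 ^ (ipart (nth 0 v 0) + ipart (nth 0 v 0)).+2;
    pow2_below (jpart (nth 0 v 0)); nth 0 v 1]) recp_covering).
  by rewrite /pow2_below /ipart /jpart; rec_env; rec_list_tac.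
have recG : recf 2 (fun v => G (nth 0 v 0) (nth 0 v 1)).
  by apply: (recf_comp1 (g := X)) => //; rewrite /jpart; rec_list_tac.
have [psi [psi_num psiP]] := search_numbering phi_num recQ recG.
(* Only here is the constant [b] of [psi] known; the indices [index_of b i] pass it to [psi] as the
   correct guess. *)
have [b [_ [t tP]]] := phi_kol psi_num.
exists b => k s k1; apply/negP => cov.
set n := 2 ^ (b + b).+2 in cov; set m := 2 ^ k in cov.
have exz : exists z, covering n m (CodeSeq.decode z).
  by exists (CodeSeq.code s); rewrite CodeSeq.codeK.
case: (ex_minnP exz) => z covz minz {s cov exz}.
set s := CodeSeq.decode z in covz.
(* All positions in [[m, 2m)] trigger the same search, hence read the same least list. *)
have psiE i : m <= i < m + m -> psi (index_of b i) =1 phi (X (nth 0 s i)).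
  move=> im; have := psiP (index_of b i) z.
  by rewrite /Q /G ipartK jpartK (pow2_belowE im) => /(_ covz minz).
have muP i : m <= i < m + m -> let mu := min_index phi (X (nth 0 s i)) in
    phi mu 0 = Some (nth 0 s i) /\ mu < n * m.
  move=> im; rewrite /min_index; case: ex_minnP => mu /asboolP muE minmu.
  split; first by rewrite muE X_sep.
  have [tle tE] := tP (index_of b i).
  apply: leq_ltn_trans (minmu (t (index_of b i)) _) _.
    by apply/asboolP => x; rewrite tE psiE.
  apply: leq_ltn_trans tle _; case/andP: im => _ im.
  have ltb := ltn_expl b (ltnSn 1).
  (* [index_of b i + 1 <= 2 ^ b * (2 i + 2)] and [i < 2 m]. *)
  have ple : (index_of b i).+1 <= 2 ^ b * (4 * m).
    apply: (@leq_trans (2 ^ b * i.*2.+2)).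
      by rewrite /index_of (mulnS _ i.*2.+1) addnC -addn1 leq_add2l expn_gt0.
    by rewrite leq_mul2l; apply/orP; right; lia.
  rewrite -mulnSr; apply: leq_ltn_trans (leq_mul (leqnn b) ple) _.
  (* One factor [2 ^ b] strictly exceeds the constant [b]; the remaining product bounds the
     index. *)
  have -> : n * m = 2 ^ b * (2 ^ b * (4 * m)) by rewrite /n !expnS expnD; lia.
  by rewrite ltn_mul2r ltb !muln_gt0 !expn_gt0.
pose mu i := min_index phi (X (nth 0 s i)).
(* The value at [0] recovers the entry, so distinct entries have distinct minimal indices. *)
have mu_uniq : uniq [seq mu i | i <- iota m m].
  rewrite map_inj_in_uniq ?iota_uniq // => i j; rewrite !mem_iota => im jm eqij.
  have [ei _] := muP _ im; have [ej _] := muP _ jm.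
  have eqe : nth 0 s i = nth 0 s j.
    by apply: Some_inj; rewrite -ei -ej; congr phi.
  have /andP[/allP uniqs _] := covz.
  have uniqij a c : c < a -> m <= c -> a < m + m -> nth 0 s a <> nth 0 s c.
    move=> ca mc am; have := uniqs a; rewrite mem_iota /= add0n => /(_ am)/allP/(_ c).
    by rewrite mem_iota /= add0n => /(_ ca); rewrite mc /= => /eqP.
  case/andP: im => mi im; case/andP: jm => mj jm.
  case: (ltngtP i j) => // lt; first by case: (uniqij j i).
  by case: (uniqij i j).
(* There are at most [m / 4] indices below [m / 4] and [m / 2] covering entries: only [3 m / 4]
   candidates for [m] distinct indices. *)
have mu_sub : {subset [seq mu i | i <- iota m m] <=
    iota 0 (2 ^ (k - 2)) ++ [seq nth 0 s j | j <- iota 0 (2 ^ (k - 1))]}.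
  have mE : m = 4 * 2 ^ (k - 2) by rewrite /m -{1}(subnK k1) expnD mulnC.
  have mE' : m = 2 * 2 ^ (k - 1) by rewrite /m -{1}(subnK (ltnW k1)) expnD mulnC.
  move=> u /mapP[i]; rewrite mem_iota => im ->{u}; rewrite mem_cat mem_iota /= add0n.
  have [_ mult] := muP _ im.
  case: (ltnP (mu i) (2 ^ (k - 2))) => //= lemu.
  have /andP[_ /allP/(_ i)] := covz; case/andP: (im) => mi im2.
  rewrite mem_iota /= add0n mi => /(_ im2) /allP/(_ (mu i)).
  rewrite mem_iota /= add0n f_min andbT mE leq_mul2l lemu /= -mE => /(_ mult) /hasP[j _].
  move=> /andP[jm /eqP <-]; apply: map_f; rewrite mem_iota /= add0n.
  by rewrite mE' mul2n -addnn in jm; lia.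
have := uniq_leq_size mu_uniq mu_sub.
rewrite size_cat !size_map !size_iota /m.
have [q ->] : exists q, k = q.+2 by exists (k - 2); lia.
have -> : q.+2 - 2 = q by lia.
have -> : q.+2 - 1 = q.+1 by lia.
by rewrite !expnS; have := expn_gt0 2 q; lia.
Qed.

(** Otherwise [S], padded with zeros to length [2 ^ k] and followed by [A], would be a covering list
    with [n = 2 ^ K]. *)
Lemma no_small_cover : exists K, forall k (A S : seq nat),
  1 < k -> uniq A -> size A = 2 ^ k -> 2 * size S <= 2 ^ k ->
  exists e u, [/\ e \in A, u \in f (X e), 2 ^ k <= 4 * u, u < 2 ^ (K + k) & u \notin S].
Proof.
have [b bP] := covering_unbounded.
exists (b + b).+2 => k A S k1 uniqA sizeA sizeS.
apply: contrapT => nex; have /negP[] := bP k (S ++ nseq (2 ^ k - size S) 0 ++ A) k1.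
set m := 2 ^ k; set s := S ++ _.
have Sm : size S <= m by rewrite /m; lia.
have nthA i : nth 0 s (m + i) = nth 0 A i.
  rewrite /s catA nth_cat size_cat size_nseq subnKC //.
  by rewrite ltnNge leq_addr /= addKn.
have nthA' i : m <= i -> nth 0 s i = nth 0 A (i - m).
  by move=> mi; rewrite -{1}(subnKC mi) nthA.
apply/andP; split; apply/allP => i; rewrite mem_iota /= add0n => im.
  apply/allP => j; rewrite mem_iota /= add0n => ji; apply/implyP => mj.
  rewrite !nthA' ?(leq_trans mj (ltnW ji)) // nth_uniq ?sizeA //; lia.
apply/implyP => mi; apply/allP => u; rewrite mem_iota /= add0n -expnD => un.
apply/implyP => /andP[mu uf]; case: (boolP (u \in S)) => uS.
  apply/hasP; exists (index u S); have := uS; rewrite -index_mem => ltS.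
    by rewrite mem_iota /= add0n (leq_trans ltS).
  rewrite /s nth_cat ltS nth_index // eqxx andbT addnn -mul2n.
  by apply: leq_trans sizeS; rewrite ltn_mul2l.
case: nex; exists (nth 0 s i), u; split=> //.
by rewrite nthA' // mem_nth // sizeA; lia.
Qed.

End SmallCover.

(** * Sparse covers *)

Lemma card_sum_bool (I : finType) (P : pred I) : #|[set x | P x]| = \sum_x P x.
Proof.
by rewrite -sum1_card big_mkcond; apply: eq_bigr => x _; rewrite inE; case: ifP.
Qed.

Section SparseCover.
Variables (T E : finType) (B : {set E}) (G : E -> {set T}) (q D r : nat).

(** The random set: a uniform [h] keeps each point independently with probability [1 / q.+1], and
    probabilities become counts of functions [h]. *)
Let zeros (h : {ffun T -> 'I_q.+1}) := [set u | h u == ord0].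
Let good (S : {set T}) := #|[set e in B | G e \subset S]|.

(** The values of [h] are forced on [A] and free elsewhere. *)
Lemma card_zeros (A : {set T}) :
  #|[set h | A \subset zeros h]| = q.+1 ^ #|~: A|.
Proof.
rewrite -[in RHS](card_ord q.+1) -(card_pffun_on ord0 (mem (~: A))) cardsE.
apply: eq_card => h; rewrite inE; apply/idP/idP => [/subsetP Ah|].
  apply/pffun_onP; split=> // ; apply/subsetP => u; rewrite !inE.
  by apply: contraNN => /Ah; rewrite inE.
move=> /pffun_onP[/subsetP hA _]; apply/subsetP => u uA; rewrite inE.
by apply: contraTT uA => hu; have := hA u hu; rewrite inE.
Qed.

(** Given that [A] is kept, the expected number of kept points is at most [#|A| + #|T| / q.+1]; the
    proof counts pairs of a function and a kept point. *)
Lemma sum_card_zeros (A : {set T}) :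
  q.+1 * (\sum_(h | A \subset zeros h) #|zeros h|) <=
  (q.+1 * #|A| + #|T|) * q.+1 ^ #|~: A|.
Proof.
have -> : \sum_(h | A \subset zeros h) #|zeros h| =
    \sum_u #|[set h | u |: A \subset zeros h]|.
  under eq_bigr => h _ do rewrite -sum1_card.
  rewrite (exchange_big_dep predT) //=; apply: eq_bigr => u _.
  rewrite -sum1_card; apply: eq_bigl => h; rewrite [RHS]inE subUset sub1set.
  by rewrite andbC.
rewrite big_distrr /=.
apply: (@leq_trans (\sum_u (q.+1 * (u \in A) + 1) * q.+1 ^ #|~: A|)).
  apply: leq_sum => u _; rewrite card_zeros; case: (boolP (u \in A)) => uA.
    rewrite (setUidPr _) ?sub1set // leq_mul2r; apply/orP; right; lia.
  rewrite muln0 add0n mul1n -expnS leq_pexp2l //.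
  by rewrite setCU setIC -setDE (cardsD1 u (~: A)) inE uA.
by rewrite -big_distrl big_split -big_distrr /= sum1_card -card_sum_bool cardsE.
Qed.

(* First moment method: each point of [T] is kept with probability [1/q.+1],
   independently; given that [G e] is kept, the expected number of kept points
   is at most [r/2], and Markov's inequality applies. *)
Lemma sparse_cover :
  {in B, forall e, #|G e| <= D} -> 0 < r ->
  2 * (q.+1 * D + #|T|) <= q.+1 * r ->
  exists S : {set T}, #|S| < r /\
    #|B| <= 2 * q.+1 ^ D * #|[set e in B | G e \subset S]|.
Proof.
move=> degB r0 qr; apply: contrapT => nex.
have small (S : {set T}) : #|S| < r -> 2 * q.+1 ^ D * good S < #|B|.
  by move=> Sr; rewrite ltnNge; apply/negP => le; case: nex; exists S.
pose W := \sum_h good (zeros h).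
have goodE h : good (zeros h) = \sum_(e in B) (G e \subset zeros h).
  rewrite /good -sum1_card [in RHS]big_mkcond [in LHS]big_mkcond /=.
  by apply: eq_bigr => e _; rewrite inE; case: (e \in B); case: (_ \subset _).
have WE : W = \sum_(e in B) q.+1 ^ #|~: G e|.
  rewrite /W; under eq_bigr => h _ do rewrite goodE.
  rewrite exchange_big /=; apply: eq_bigr => e _; rewrite -card_zeros -sum1_card.
  by rewrite [in RHS]big_mkcond /=; apply: eq_bigr => h _; rewrite inE; case: ifP.
have W_moment : q.+1 * (\sum_h good (zeros h) * #|zeros h|) <= (q.+1 * D + #|T|) * W.
  have -> : \sum_h good (zeros h) * #|zeros h| =
      \sum_(e in B) \sum_(h | G e \subset zeros h) #|zeros h|.
    under eq_bigr => h _ do rewrite goodE big_distrl /=.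
    rewrite exchange_big /=; apply: eq_bigr => e _; rewrite [in RHS]big_mkcond /=.
    by apply: eq_bigr => h _; case: ifP; rewrite ?mul1n ?mul0n.
  rewrite WE !big_distrr /=; apply: leq_sum => e eB.
  apply: leq_trans (sum_card_zeros _) _; rewrite leq_mul2r; apply/orP; right.
  by rewrite leq_add2r leq_mul2l degB ?orbT.
pose lo := \sum_(h | #|zeros h| < r) good (zeros h).
pose hi := \sum_(h | ~~ (#|zeros h| < r)) good (zeros h).
have Wsplit : W = lo + hi by rewrite /W (bigID (fun h => #|zeros h| < r)).
have hi_r : r * hi <= \sum_h good (zeros h) * #|zeros h|.
  rewrite big_distrr /= [X in _ <= X](bigID (fun h => #|zeros h| < r)) /=.
  apply: leq_trans (leq_addl _ _); apply: leq_sum => h; rewrite -leqNgt => rh.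
  by rewrite mulnC leq_mul2l rh orbT.
(* Markov: sets with at least [r] points account for at most half of [W]. *)
have W_lo : W <= 2 * lo.
  have : q.+1 * r * (2 * hi) <= q.+1 * r * W.
    have h1 : q.+1 * (r * hi) <= (q.+1 * D + #|T|) * W.
      by apply: leq_trans W_moment; rewrite leq_mul2l hi_r.
    have h2 : 2 * (q.+1 * D + #|T|) * W <= q.+1 * r * W by rewrite leq_mul2r qr orbT.
    have -> : q.+1 * r * (2 * hi) = 2 * (q.+1 * (r * hi)) by lia.
    by apply: leq_trans h2; rewrite -mulnA leq_mul2l.
  by rewrite leq_pmul2l ?muln_gt0 ?r0 //; lia.
have W_B : #|B| * q.+1 ^ #|T| <= q.+1 ^ D * W.
  rewrite WE big_distrr /= -sum1_card big_distrl /=; apply: leq_sum => e eB.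
  rewrite mul1n -expnD leq_pexp2l // -(cardsC (G e)) leq_add2r; exact: degB.
(* By contradiction hypothesis each set with fewer than [r] points contains [G e] for too few [e];
   strictness gives the predecessor of [#|B|]. *)
have lo_B : 2 * q.+1 ^ D * lo <= #|B|.-1 * q.+1 ^ #|T|.
  have -> : q.+1 ^ #|T| = \sum_(h : {ffun T -> 'I_q.+1}) 1.
    by rewrite sum1_card card_ffun card_ord.
  rewrite !big_distrr /= [X in _ <= X](bigID (fun h => #|zeros h| < r)) /=.
  apply: leq_trans (leq_addr _ _); apply: leq_sum => h /small.
  by case: #|B| => // b; rewrite muln1.
have B0 : 0 < #|B|.
  by apply: leq_ltn_trans (small set0 _); rewrite ?cards0.
have : q.+1 ^ D * W <= 2 * q.+1 ^ D * lo.
  by rewrite [2 * _]mulnC -mulnA leq_mul2l W_lo orbT.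
move=> /leq_trans/(_ lo_B)/(leq_trans W_B); rewrite leq_mul2r expn_eq0 /=.
by move: B0; case: #|B| => // b _; rewrite ltnn.
Qed.

End SparseCover.

(** * A long list exists *)

Section LongList.
Variables (g : nat -> seq nat) (K : nat).
Hypothesis no_cover : forall k (A S : seq nat),
  1 < k -> uniq A -> size A = 2 ^ k -> 2 * size S <= 2 ^ k ->
  exists e u, [/\ e \in A, u \in g e, 2 ^ k <= 4 * u, u < 2 ^ (K + k) & u \notin S].

Definition level k u := (2 ^ k <= 4 * u) && (u < 2 ^ (K + k)).

Definition level_set k e : {set 'I_(2 ^ (K + k))} :=
  [set u : 'I_(2 ^ (K + k)) | (val u \in g e) && level k u].

Lemma few_low_degree n k d : 2 < k -> d <= 2 ^ (k - 3) ->
  #|[set e : 'I_(2 ^ n) | #|level_set k e| <= d]| <= 2 ^ ((K + 3) * d + k).+1.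
Proof.
(* Among [2 ^ (K + k)] points, [2 ^ (k - 3)] are expected to be kept; with at most [2 ^ (k - 3)]
   forced points this is at most half of the threshold [2 ^ k.-1]. *)
move=> k2 dk; set B := [set e | _]; pose q := (2 ^ (K + 3)).-1.
have qE : q.+1 = 2 ^ (K + 3) by rewrite prednK // expn_gt0.
have [||| S [Sr BS]] := @sparse_cover _ _ B (level_set k) q d (2 ^ k.-1).
- by move=> e; rewrite inE.
- by rewrite expn_gt0.
- have [j kE] : exists j, k = j.+3 by exists (k - 3); lia.
  move: dk; rewrite card_ord qE kE; have -> : j.+3 - 3 = j by lia.
  rewrite /= !addnS addn0 !expnS expnD => dk.
  have : 2 ^ K * d <= 2 ^ K * 2 ^ j by rewrite leq_mul2l dk orbT.
  have -> : 2 * (2 * (2 * 2 ^ K)) * (2 * (2 * 2 ^ j)) = 32 * (2 ^ K * 2 ^ j) by lia.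
  rewrite -!mulnA; lia.
apply: leq_trans BS _; rewrite qE -expnM -expnS -addSn [X in _ <= X]expnD leq_mul2l.
apply/orP; right; rewrite leqNgt; apply/negP => lt; move/ltnW in lt.
set C := [set e in B | _] in lt.
(* [2 ^ k] numbers with level sets inside [S] would contradict [no_cover], since
   [2 * #|S| <= 2 ^ k]. *)
have [||||e [u []]] := @no_cover k (take (2 ^ k) [seq val e | e <- enum C])
  [seq val u | u <- enum S].
- exact: ltnW.
- by rewrite take_uniq // map_inj_uniq ?enum_uniq //; exact: val_inj.
- by rewrite size_takel // size_map -cardE.
- by rewrite size_map -cardE -[X in _ <= 2 ^ X](prednK (ltnW (ltnW k2))) expnS leq_mul2l ltnW.
move=> /mem_take/mapP[e']; rewrite mem_enum inE => /andP[_ /subsetP GS] -> ug ku uk.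
case/negP; apply/mapP; exists (Ordinal uk) => //; rewrite mem_enum; apply: GS.
by rewrite inE /= ug /level ku uk.
Qed.

Lemma card_level_set k e : #|level_set k e| <= count (level k) (g e).
Proof.
rewrite cardE -(size_map val) -size_filter; apply: uniq_leq_size => [|u].
  by rewrite map_inj_uniq ?enum_uniq //; exact: val_inj.
by move=> /mapP[v]; rewrite mem_enum inE mem_filter andbC => vg ->.
Qed.

(** A level spans [K + 2] binary orders of magnitude, so levels [K + 3] apart are disjoint and each
    entry is counted at most once. *)
Lemma sum_count_level l a s :
  \sum_(i < l) count (level (a + i * (K + 3))) s <= size s.
Proof.
elim: s => [|u s IHs] /=; first by rewrite big1.
rewrite big_split /= -[X in _ <= X]add1n; apply: leq_add => //.
have -> : \sum_(i < l) level (a + i * (K + 3)) u =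
    #|[set i : 'I_l | level (a + i * (K + 3)) u]|.
  by rewrite card_sum_bool.
have le i j : level (a + i * (K + 3)) u -> level (a + j * (K + 3)) u -> i <= j.
  move=> /andP[iu _] /andP[_ ju]; rewrite leqNgt; apply/negP => ji.
  have : 2 ^ (a + i * (K + 3)) < 2 ^ (K + (a + j * (K + 3))).+2.
    by apply: leq_ltn_trans iu _; rewrite !expnS; lia.
  rewrite ltn_exp2l //; nia.
apply/card_le1_eqP => i j; rewrite !inE => iu ju.
by apply/val_inj/eqP; rewrite eqn_leq !le.
Qed.

Lemma long_list l : 0 < l ->
  exists2 e, e < 2 ^ (4 * (K + 3) * l) & l * l <= 2 * size (g e).
Proof.
(* The offset [l.+3] ensures [l <= 2 ^ (k i - 3)], and [n] is large enough that at each of the [l]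
   levels at most half of the [e] have low degree. *)
move=> l0; set n := 4 * _ * l; pose k i := l.+3 + i * (K + 3).
pose high e := #|[set i : 'I_l | l < #|level_set (k i) e|]|.
have few (i : 'I_l) : 2 * #|[set e : 'I_(2 ^ n) | #|level_set (k i) e| <= l]| <= 2 ^ n.
  have ki : 2 < k i by rewrite /k; lia.
  have lk : l <= 2 ^ (k i - 3).
    by apply: leq_trans (ltnW (ltn_expl l (ltnSn 1))) _; rewrite leq_exp2l // /k; lia.
  apply: (@leq_trans (2 ^ ((K + 3) * l + k i).+2)).
    by rewrite expnS leq_mul2l few_low_degree.
  rewrite leq_exp2l // /n /k; have := ltn_ord i; nia.
(* Double counting of pairs [(e, i)] with more than [l] elements of [g e] at level [k i]. *)
have high_sum : l * 2 ^ n <= 2 * \sum_(e < 2 ^ n) high e.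
  have -> : \sum_(e < 2 ^ n) high e =
      \sum_(i < l) #|[set e : 'I_(2 ^ n) | l < #|level_set (k i) e|]|.
    under eq_bigr => e _ do rewrite /high card_sum_bool.
    by rewrite exchange_big; apply: eq_bigr => i _; rewrite card_sum_bool.
  rewrite big_distrr /= -[X in X * _](card_ord l) -sum1_card big_distrl /=.
  apply: leq_sum => i _; have := few i.
  have := cardsC [set e : 'I_(2 ^ n) | #|level_set (k i) e| <= l].
  rewrite card_ord (_ : ~: _ = [set e : 'I_(2 ^ n) | l < #|level_set (k i) e|]); last first.
    by apply/setP => e; rewrite !inE ltnNge.
  have complement a b c : a + b = c -> 2 * a <= c -> 1 * c <= 2 * b by lia.
  exact: complement.
(* Averaging: some [e] is high on at least half of the levels. *)
have [e he] : exists e : 'I_(2 ^ n), l <= 2 * high e.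
  apply: contrapT => nex.
  have : 2 * \sum_(e < 2 ^ n) high e <= \sum_(e < 2 ^ n) l.-1.
    rewrite big_distrr; apply: leq_sum => e _.
    by rewrite -ltnS prednK // ltnNge; apply/negP => le; case: nex; exists e.
  rewrite sum_nat_const card_ord; have := expn_gt0 2 n; nia.
exists e => //; apply: (@leq_trans (l * (2 * high e))); first by rewrite leq_mul2l he orbT.
rewrite mulnCA leq_mul2l /=; apply: leq_trans (sum_count_level l l.+3 (g e)).
rewrite /high mulnC -sum_nat_const big_mkcond /=; apply: leq_sum => i _.
by case: ifP => //; rewrite inE => /ltnW lt; exact: leq_trans (card_level_set _ _).
Qed.

End LongList.

(* Passage to real logarithms and infinitely many indices *)
From mathcomp Require Import all_order all_algebra.
From mathcomp Require Import classical_sets cardinality reals exp.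
Import Order.TTheory GRing.Theory Num.Theory.
Local Open Scope classical_set_scope.
Local Open Scope ring_scope.

Unset Implicit Arguments.

Lemma ln_nat_bound (R : realType) (x m : nat) :
  (x <= 2 ^ m)%N -> 0 <= ln (x%:R : R) <= ln (2 : R) *+ m.
Proof.
(* By convention [ln 0 = 0]. *)
case: x => [_|x xm]; first by rewrite ln0 // lexx mulrn_wge0 // ln_ge0 // ler1n.
rewrite ln_ge0 ?ler1n //= -lnXn // ler_ln ?posrE ?ltr0n ?exprn_gt0 //.
by rewrite -natrX ler_nat.
Qed.

Theorem theorem4p5 (R : realType) (phi : nat -> nat -> option nat)
    (f : nat -> seq nat) :
  numbering phi ->
  kolmogorov_property phi ->
  computable_to_lists f ->
  (forall x : nat, min_index phi x \in f x) ->
  exists2 c : R, 0 < c &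
    infinite_set [set x : nat | c * ln (x%:R : R) ^+ 2 <= (size (f x))%:R].
Proof.
move=> phi_num phi_kol f_comp f_min.
have [c [X [c0 X_comp X_le X_sep]]] := separated_indices phi_num phi_kol.
have [K no_cover] := no_small_cover phi_num phi_kol f_comp f_min X_comp X_sep.
(* For [l > 0], [X e <= c (e + 1) <= 2 ^ (a l)], so [ln (X e) <= b l]. *)
pose a := (c + 4 * (K + 3))%N; pose b : R := ln 2 *+ a.
have b0 : 0 < b by rewrite pmulrn_lgt0 ?ln_gt0 ?ltr1n // /a; lia.
(* Chosen so that [(b l) ^ 2] becomes [l ^ 2 / 2], the bound on the list size. *)
exists (2 * b ^+ 2)^-1; first by rewrite invr_gt0 mulr_gt0 // exprn_gt0.
move=> /finite_seqP[s sE].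
(* If [M] is the largest list size on the supposedly finite set, [l = 2 M + 1] forces
   [l ^ 2 <= 2 M], which is absurd. *)
pose l := (2 * \max_(x <- s) size (f x)).+1.
have [e e_lt e_size] := long_list no_cover (ltn0Sn _ : (0 < l)%N).
have X_lt : (X e <= 2 ^ (a * l))%N.
  apply: leq_trans (X_le e) _; rewrite -mulnSr /a mulnDl expnD leq_mul //.
  by apply: leq_trans (ltnW (ltn_expl c (ltnSn 1))) _; rewrite leq_exp2l // leq_pmulr.
have X_in : X e \in s.
  have : [set` s] (X e); last by [].
  rewrite -sE /=; have /andP[lnx0 lnb] := ln_nat_bound R _ _ X_lt; rewrite mulrnA -/b in lnb.
  rewrite ler_pdivrMl ?mulr_gt0 ?exprn_gt0 //.
  apply: (@le_trans _ _ ((b *+ l) ^+ 2)).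
    by apply: lerXn2r => //; rewrite nnegrE // mulrn_wge0 // ltW.
  rewrite -[b *+ l]mulr_natr exprMn [2 * _]mulrC -[leRHS]mulrA ler_pM2l ?exprn_gt0 //.
  by rewrite -natrX -natrM ler_nat -mulnn.
have : (size (f (X e)) <= \max_(x <- s) size (f x))%N.
  by apply: leq_bigmax_seq.
move: e_size; rewrite /l; move: (\max_(x <- s) _) => M; nia.
Qed.
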